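(* The family $E_{3d}=E_{3d}(e_1,e_3,e_4,e_6)$ admits a shift operator for each of the shifts $e_1\to e_1\pm1$ and $e_i\to e_i\pm2$ ($i=3,4,6$), where in each case the other three of the free parameters $e_1,e_3,e_4,e_6$ are kept fixed.
   Context: Let $\partial=d/dx$ and $D=\mathbb{C}(x)[\partial]$. The operator $E_3(e)$: for $e=(e_1,\dots,e_7)$ with $e_1+\cdots+e_7=3$, put $$E_3(e)=x^2(x-1)^2\partial^3+x(x-1)(a_{21}x+a_{20})\partial^2+(a_{12}x^2+a_{11}x+a_{10})\partial+a_{01}x+A_{00}(e),$$ where $a_{21}=6-e_1-e_2-e_3-e_4$, $a_{20}=-3+e_1+e_2$, $a_{12}=(e_5+e_6+1)e_7+(e_6+1)(e_5+1)$, $a_{11}=-(e_5+e_6)e_7-e_1e_2+e_3e_4-e_5e_6+2e_1+2e_2-4$, $a_{10}=(e_1-1)(e_2-1)$, $a_{01}=e_5e_6e_7$, and $$\begin{aligned}54A_{00}(e)=&-4(e_1+e_2-e_3-e_4)^3-27e_5e_6e_7+9(e_1+e_2-e_3-e_4)(e_5e_6+e_5e_7+e_6e_7-2)\\&+9e_1e_2(e_1+e_2-1)+18(e_1+e_2-1)(e_3^2+e_3e_4+e_4^2)\\&-9e_3e_4(e_3+e_4-1)-18(e_3+e_4-1)(e_1^2+e_1e_2+e_2^2).\end{aligned}$$ $E_{3d}(e_1,e_3,e_4,e_6)$ is the specialization of $E_3(e)$ by $e_2=-\tfrac{e_3}{2}-\tfrac{e_4}{2}+\tfrac32-e_1-\tfrac{3e_6}{2}$,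 $e_5=e_1+e_6$ (and $e_7=3-(e_1+\cdots+e_6)$). Shift operators: let $E(p)$ be a family of third-order operators depending on parameters $p$, irreducible for generic $p$, and let $p\to p_+$ be a shift of the parameters by integers. A shift operator for this shift is a non-zero operator $P\in D$ of order lower than $3$, depending on $p$, sending the solution space of $E(p)$ to the solution space of $E(p_+)$; equivalently, there is $Q\in D$ with $E(p_+)\circ P=Q\circ E(p)$. The parameters are regarded as generic (indeterminates); the coefficients of $P$ are rational functions of $x$ and of $p$ (poles in $x$ are allowed; after normalization they may be taken polynomial in $p$ without common factor). *)

(* Defs.v *)
From mathcomp Require Import all_boot all_order all_algebra ring.
From mathcomp Require Import reals.
From mathcomp.real_closed Require Import complex.
From mathcomp.multinomials Require Import mpoly.

Set Implicit Arguments.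
Unset Strict Implicit.
Unset Printing Implicit Defensive.

Import GRing.Theory.
Local Open Scope ring_scope.
Local Open Scope quotient_scope.

Local Notation "x %:F" := (FracField.tofrac x).

Notation ratfun F := {fraction {poly F}}.

Section RationalFunctions.
Variable F : fieldType.

(* d/dx, by the quotient rule on the canonical representative; by
   [rderiv_frac] any other representative gives the same value. *)
Definition rderiv (f : ratfun F) : ratfun F :=
  let n := \n_(repr f) in let d := \d_(repr f) in
  (n^`() * d - n * d^`())%:F / (d ^+ 2)%:F.

Lemma ratfunE (f : ratfun F) : f = (\n_(repr f))%:F / (\d_(repr f))%:F.
Proof.
rewrite -[LHS]reprK; move: (repr f) => r; unlock FracField.tofrac.
rewrite -[X in _ = _ * X]FracField.pi_inv -[RHS]FracField.pi_mul.
rewrite /FracField.mulf /FracField.invf !numden_Ratio ?oner_neq0 ?denom_ratioP //.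
by rewrite mulr1 mul1r Ratio_numden.
Qed.

Lemma rderiv_frac (n d : {poly F}) : d != 0 ->
  rderiv (n%:F / d%:F) = (n^`() * d - n * d^`())%:F / (d ^+ 2)%:F.
Proof.
move=> d0; rewrite /rderiv; set f := (X in repr X).
have Ef : f = n%:F / d%:F by [].
have := ratfunE f; have := denom_ratioP (repr f); rewrite Ef.
move: (\n_(repr f)) (\d_(repr f)) => {f Ef} a b b0 /eqP.
have dF0 : d%:F != 0 by rewrite tofrac_eq0.
have bF0 : b%:F != 0 by rewrite tofrac_eq0.
rewrite (eqr_div _ _ dF0 bF0) -!tofracM tofrac_eq => /eqP E.
have E' : (n * b)^`() = (a * d)^`() by rewrite E.
rewrite !derivM in E'; apply/eqP.
have d2 : (d ^+ 2)%:F != 0 by rewrite tofrac_eq0 expf_neq0.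
have b2 : (b ^+ 2)%:F != 0 by rewrite tofrac_eq0 expf_neq0.
rewrite (eqr_div _ _ b2 d2) -!tofracM tofrac_eq; apply/eqP.
have -> : (a^`() * b - a * b^`()) * d ^+ 2 =
   ((a^`() * d + a * d^`()) * b - b^`() * (a * d)) * d - (a * d) * b * d^`() by ring.
by rewrite -E -E'; ring.
Qed.

Lemma rderiv_poly (p : {poly F}) : rderiv p%:F = p^`()%:F.
Proof.
rewrite -[p%:F in LHS]divr1 -tofrac1 rderiv_frac ?oner_neq0 //.
by rewrite expr1n tofrac1 divr1 derivE mulr0 subr0 mulr1.
Qed.

Lemma rderivD : {morph rderiv : f g / f + g}.
Proof.
move=> f g; rewrite (ratfunE f) (ratfunE g).
move: (denom_ratioP (repr f)) (denom_ratioP (repr g)).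
move: (\n_(repr f)) (\d_(repr f)) (\n_(repr g)) (\d_(repr g)) => a b c d b0 d0.
rewrite addf_div ?tofrac_eq0 ?b0 ?d0 // -!tofracM -tofracD !rderiv_frac ?mulf_neq0 //.
rewrite addf_div ?tofrac_eq0 ?expf_neq0 // -!tofracM -tofracD.
rewrite !derivD !derivM exprMn; congr (_%:F / _); ring.
Qed.

Lemma rderivM f g : rderiv (f * g) = rderiv f * g + f * rderiv g.
Proof.
rewrite (ratfunE f) (ratfunE g).
move: (denom_ratioP (repr f)) (denom_ratioP (repr g)).
move: (\n_(repr f)) (\d_(repr f)) (\n_(repr g)) (\d_(repr g)) => a b c d b0 d0.
rewrite mulf_div -!tofracM !rderiv_frac ?mulf_neq0 //.
rewrite !mulf_div -!tofracM addf_div ?tofrac_eq0 ?mulf_neq0 ?expf_neq0 //.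
rewrite -!tofracM -tofracD !derivM; apply/eqP.
rewrite eqr_div ?tofrac_eq0 ?mulf_neq0 ?expf_neq0 ?mulf_neq0 // -!tofracM tofrac_eq.
by apply/eqP; ring.
Qed.

End RationalFunctions.

(* F(x)[d]: the operator sum_i p_i d^i is stored as the polynomial with
   coefficients p_i, so the outer 'X stands for d = d/dx.  Only the F(x)-vector
   space structure of {poly _} is meaningful here: its commutative product is
   not the product of operators, which is [dcomp] (see [dcomp_apply]). *)
Notation diffop F := {poly ratfun F}.

Section DifferentialOperators.
Variable F : fieldType.

Definition dorder (P : diffop F) : nat := (size P).-1.

(* d o (sum_i p_i d^i) = sum_i p_i' d^i + sum_i p_i d^(i+1) *)
Definition dmul (P : diffop F) : diffop F :=
  map_poly (@rderiv F) P + P * 'X.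

Definition dcomp (P Q : diffop F) : diffop F :=
  \sum_(i < size P) P`_i *: iter i dmul Q.

Definition dapply (P : diffop F) (f : ratfun F) : ratfun F :=
  \sum_(i < size P) P`_i * iter i (@rderiv F) f.

Lemma rderiv0 : rderiv 0 = 0 :> ratfun F.
Proof. by rewrite -tofrac0 rderiv_poly derivE. Qed.

Lemma dapply_widen n (P : diffop F) f : (size P <= n)%N ->
  dapply P f = \sum_(i < n) P`_i * iter i (@rderiv F) f.
Proof.
move=> le; rewrite /dapply (big_ord_widen n (fun i => P`_i * iter i (@rderiv F) f)) //.
rewrite big_mkcond; apply: eq_bigr => i _; case: ltnP => // h.
by rewrite nth_default ?mul0r.
Qed.

Lemma dapplyD P Q f : dapply (P + Q) f = dapply P f + dapply Q f.
Proof.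
rewrite (dapply_widen (n := maxn (size P) (size Q))) ?size_polyD //.
rewrite (dapply_widen (P := P) _ (leq_maxl _ (size Q))).
rewrite (dapply_widen (P := Q) _ (leq_maxr (size P) _)) -big_split /=.
by apply: eq_bigr => i _; rewrite coefD mulrDl.
Qed.

Lemma dapplyZ c P f : dapply (c *: P) f = c * dapply P f.
Proof.
rewrite (dapply_widen (n := size P)) ?size_scale_leq // mulr_sumr.
by apply: eq_bigr => i _; rewrite coefZ mulrA.
Qed.

Lemma dapply_dmul P f : dapply (dmul P) f = rderiv (dapply P f).
Proof.
rewrite /dmul dapplyD.
rewrite (dapply_widen (n := size P)) ?size_poly //.
rewrite (dapply_widen (P := P * 'X) (n := (size P).+1)); last first.
  by rewrite (leq_trans (size_polyMleq _ _)) // size_polyX addn2.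
rewrite big_ord_recl /= coefMX mul0r add0r -big_split /=.
rewrite [in RHS]/dapply (big_morph _ (@rderivD F) rderiv0).
apply: eq_bigr => i _; rewrite rderivM coefMX /=; congr (_ * _ + _).
by rewrite coef_map_id0 // rderiv0.
Qed.

Lemma dcomp_apply P Q f : dapply (dcomp P Q) f = dapply P (dapply Q f).
Proof.
have d0 : dapply 0 f = 0 by rewrite /dapply size_poly0 big_ord0.
rewrite /dcomp (big_morph (dapply^~ f) (fun P Q => dapplyD P Q f) d0).
apply: eq_bigr => i _; rewrite dapplyZ; congr (_ * _).
by elim: {i}(i : nat) => //= i <-; rewrite dapply_dmul.
Qed.

(* P maps the solutions of E to those of E', in the form of an intertwining
   relation E' o P = Q o E. *)
Definition is_shift_operator (E E' P : diffop F) : Prop :=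
  [/\ P != 0, (dorder P < 3)%N &
      exists Q : diffop F, dcomp E' P = dcomp Q E].

End DifferentialOperators.

Section OperatorE3.
Variable F : fieldType.
Variables e1 e2 e3 e4 e5 e6 e7 : F.

Definition a21 : F := 6 - e1 - e2 - e3 - e4.
Definition a20 : F := - 3 + e1 + e2.
Definition a12 : F := (e5 + e6 + 1) * e7 + (e6 + 1) * (e5 + 1).
Definition a11 : F :=
  - (e5 + e6) * e7 - e1 * e2 + e3 * e4 - e5 * e6 + 2 * e1 + 2 * e2 - 4.
Definition a10 : F := (e1 - 1) * (e2 - 1).
Definition a01 : F := e5 * e6 * e7.
Definition A00 : F :=
  (- 4 * (e1 + e2 - e3 - e4) ^+ 3 - 27 * e5 * e6 * e7
   + 9 * (e1 + e2 - e3 - e4) * (e5 * e6 + e5 * e7 + e6 * e7 - 2)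
   + 9 * e1 * e2 * (e1 + e2 - 1)
   + 18 * (e1 + e2 - 1) * (e3 ^+ 2 + e3 * e4 + e4 ^+ 2)
   - 9 * e3 * e4 * (e3 + e4 - 1)
   - 18 * (e3 + e4 - 1) * (e1 ^+ 2 + e1 * e2 + e2 ^+ 2)) / 54.

(* In the coefficients (under %:F) 'X is the variable x; outside it is d. *)
Definition E3 : diffop F :=
    ('X ^+ 2 * ('X - 1) ^+ 2)%:F *: 'X^3
  + ('X * ('X - 1) * (a21 *: 'X + a20%:P))%:F *: 'X^2
  + (a12 *: 'X^2 + a11 *: 'X + a10%:P)%:F *: 'X
  + (a01 *: 'X + A00%:P)%:F%:P.

End OperatorE3.

Definition E3d (F : fieldType) (e1 e3 e4 e6 : F) : diffop F :=
  let e2 := - e3 / 2 - e4 / 2 + 3 / 2 - e1 - 3 * e6 / 2 in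
  let e5 := e1 + e6 in
  let e7 := 3 - (e1 + e2 + e3 + e4 + e5 + e6) in
  E3 e1 e2 e3 e4 e5 e6 e7.

Section GenericParameters.
Variable R : realType.

(* C(e1, e3, e4, e6) with independent indeterminates; the free parameters are
   the variables number 0, 1, 2, 3 in this order. *)
Definition parfield : fieldType := {fraction {mpoly R[i][4]}}.

Definition par (k : 'I_4) : parfield := ('X_k : {mpoly R[i][4]})%:F.

(* The family E3d with generic parameters has a shift operator for the shift
   (e1, e3, e4, e6) -> (e1 + s1, e3 + s3, e4 + s4, e6 + s6). *)
Definition E3d_has_shift_operator (s1 s3 s4 s6 : int) : Prop :=
  let e1 := par (inord 0) in let e3 := par (inord 1) in
  let e4 := par (inord 2) in let e6 := par (inord 3) in
  exists P : diffop parfield,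
    is_shift_operator (E3d e1 e3 e4 e6)
      (E3d (e1 + s1%:~R) (e3 + s3%:~R) (e4 + s4%:~R) (e6 + s6%:~R)) P.

End GenericParameters.

(* Main.v *)
Require Import Defs.
From mathcomp Require Import all_boot all_order all_algebra reals.
From HB Require Import structures.
From mathcomp Require Import ring.
From mathcomp.real_closed Require Import complex.
From mathcomp.multinomials Require Import mpoly.

(* Since e5 = e1 + e6 and e7 = e2 + e6, the Riemann scheme of E3d, multiplied by
   x^(e6/2), is symmetric under x -> 1/x, so E3d is the pullback by
   z = -(x-1)^2/(4x) of a 3F2 operator with exponents 0, 1, 1/2 at z = 1, the
   branch value at x = -1.  With D the conjugate of z d/dz by x^(e6/2),
     E3d = 4(x+1)/(x-1) (D (D - e3/2) (D - e4/2) - z (D + a0) (D + a1) (D + a2)),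
   where a0 = e6/2, a1 = a0 + e1, a2 = a0 + e2.  Each required shift is a composite of
   shifts of one a_i or one e_i/2 by 1, and of a conjugation by x when e6 moves.  A unit
   shift comes from factorisations E = Q P + c, E' = P Q + c with a constant c,
   which give E' P = P E, E Q = Q E' and Q P = -c modulo E; c is nonzero for generic
   parameters.  Pairs (P, Q) inverse to each other up to a nonzero constant compose,
   and such a P reduced modulo E has order below 3 and is nonzero. *)

Set Implicit Arguments.
Unset Strict Implicit.
Unset Printing Implicit Defensive.

Import GRing.Theory Num.Theory.
Local Open Scope ring_scope.
Local Notation "x %:F" := (FracField.tofrac x).

(** * The algebra of differential operators *)

Section DopRing.
Variable F : fieldType.
Implicit Types (P Q S : diffop F) (f g : ratfun F).

Lemma coef_dmul P i :
  (dmul P)`_i = rderiv P`_i + (if i is j.+1 then P`_j else 0).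
Proof.
rewrite coefD coefMX coef_map_id0 ?rderiv0 //.
by case: i.
Qed.

Lemma dmulD P Q : dmul (P + Q) = dmul P + dmul Q.
Proof.
apply/polyP => i; rewrite coef_dmul [RHS]coefD !coef_dmul coefD rderivD.
by case: i => [|i]; rewrite ?coefD ?addr0 // addrACA.
Qed.

Lemma dmulZ f P : dmul (f *: P) = rderiv f *: P + f *: dmul P.
Proof.
apply/polyP => i; rewrite coef_dmul [RHS]coefD !coefZ coef_dmul rderivM mulrDr addrA.
by case: i => [|i]; rewrite ?coefZ ?mulr0.
Qed.

Lemma iter_dmulD n P Q :
  iter n (@dmul F) (P + Q) = iter n (@dmul F) P + iter n (@dmul F) Q.
Proof. by elim: n => //= n ->; rewrite dmulD. Qed.

Lemma dcomp_widen n P Q : (size P <= n)%N ->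
  dcomp P Q = \sum_(i < n) P`_i *: iter i (@dmul F) Q.
Proof.
move=> le; rewrite /dcomp (big_ord_widen n (fun i => P`_i *: iter i (@dmul F) Q)) //.
rewrite big_mkcond; apply: eq_bigr => i _; case: ltnP => // h.
by rewrite nth_default ?scale0r.
Qed.

Lemma dcompDl : left_distributive (@dcomp F) +%R.
Proof.
move=> P Q S.
rewrite (dcomp_widen (n := maxn (size P) (size Q))) ?size_polyD //.
rewrite (dcomp_widen (P := P) _ (leq_maxl _ (size Q))).
rewrite (dcomp_widen (P := Q) _ (leq_maxr (size P) _)) -big_split /=.
by apply: eq_bigr => i _; rewrite coefD scalerDl.
Qed.

Lemma dcompDr : right_distributive (@dcomp F) +%R.
Proof.
move=> P Q S; rewrite -big_split; apply: eq_bigr => i _.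
by rewrite iter_dmulD scalerDr.
Qed.

Lemma dcompZl f P Q : dcomp (f *: P) Q = f *: dcomp P Q.
Proof.
rewrite (dcomp_widen (n := size P)) ?size_scale_leq // scaler_sumr.
by apply: eq_bigr => i _; rewrite coefZ scalerA.
Qed.

Lemma dcomp0l Q : dcomp 0 Q = 0.
Proof. by rewrite /dcomp size_poly0 big_ord0. Qed.

Lemma dmul0 : dmul 0 = 0 :> diffop F.
Proof. by rewrite -(scale0r 1) dmulZ rderiv0 !scale0r addr0. Qed.

(** This is associativity for the left factor d. It comes from the Leibniz rule [dmulZ], and
    induction on powers of d extends it to all operators. *)
Lemma dcomp_dmul P Q : dcomp (dmul P) Q = dmul (dcomp P Q).
Proof.
rewrite /dmul dcompDl -!/(dmul _).
rewrite (dcomp_widen (n := size P)) ?size_poly //.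
rewrite (dcomp_widen (P := P * 'X) (n := (size P).+1)); last first.
  by rewrite (leq_trans (size_polyMleq _ _)) // size_polyX addn2.
rewrite big_ord_recl /= coefMX scale0r add0r -big_split /=.
rewrite [in RHS]/dcomp (big_morph _ dmulD dmul0).
apply: eq_bigr => i _; rewrite dmulZ coefMX /=; congr (_ *: _ + _).
by rewrite coef_map_id0 // rderiv0.
Qed.

Lemma dcompA : associative (@dcomp F).
Proof.
move=> P Q S; symmetry.
rewrite {2}/dcomp (big_morph (@dcomp F ^~ S) (fun P Q => dcompDl P Q S) (dcomp0l S)).
apply: eq_bigr => i _; rewrite dcompZl; congr (_ *: _).
by elim: {i}(i : nat) => //= i <-; rewrite dcomp_dmul.
Qed.

Lemma dcomp1l : left_id 1 (@dcomp F).
Proof. by move=> P; rewrite /dcomp size_poly1 big_ord1 coef1 scale1r. Qed.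

Lemma dmulXn n : dmul 'X^n = 'X^(n.+1) :> diffop F.
Proof.
apply/polyP => i; rewrite coef_dmul !coefXn.
have r1 : rderiv 1 = 0 :> ratfun F by rewrite -tofrac1 rderiv_poly derivE tofrac0.
by case: i => [|i]; case: (_ == _); rewrite ?r1 ?rderiv0 ?coefXn ?add0r ?addr0.
Qed.

Lemma dcomp1r : right_id 1 (@dcomp F).
Proof.
move=> P; rewrite -[RHS]coefK poly_def; apply: eq_bigr => i _; congr (_ *: _).
by elim: {i}(i : nat) => [|i /= ->]; rewrite ?expr0 ?dmulXn.
Qed.

(* A fresh name for the type, so that its product can be the composition of
   operators rather than the product of {poly _}. *)
Definition dop : Type := diffop F.
HB.instance Definition _ := GRing.Zmodule.on dop.
HB.instance Definition _ := GRing.Zmodule_isNzRing.Build dop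
  dcompA dcomp1l dcomp1r dcompDl dcompDr (oner_neq0 (diffop F)).

(** Only constants act as scalars: their derivative vanishes, so they commute with d, and [dop]
    becomes an algebra over [F] but not over F(x). *)
Definition dscale (c : F) (P : dop) : dop := (c%:P%:F *: P : diffop F).

Fact dscaleA a b P : dscale a (dscale b P) = dscale (a * b) P.
Proof. by rewrite /dscale scalerA -tofracM -polyCM. Qed.
Fact dscale1 : left_id 1 dscale.
Proof. by move=> P; rewrite /dscale tofrac1 scale1r. Qed.
Fact dscaleDr : right_distributive dscale +%R.
Proof. by move=> a P Q; rewrite /dscale scalerDr. Qed.
Fact dscaleDl P : {morph dscale^~ P : a b / a + b}.
Proof. by move=> a b; rewrite /dscale polyCD tofracD scalerDl. Qed.
HB.instance Definition _ := GRing.Zmodule_isLmodule.Build F dop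
  dscaleA dscale1 dscaleDr dscaleDl.

Fact dscaleAl (a : F) (P Q : dop) : a *: (P * Q) = (a *: P) * Q.
Proof. by symmetry; exact: dcompZl. Qed.
HB.instance Definition _ := GRing.Lmodule_isLalgebra.Build F dop dscaleAl.

Lemma dscaleE (a : F) (P : dop) : a *: P = (a%:P%:F *: (P : diffop F)) :> diffop F.
Proof. by []. Qed.

Lemma iter_dmulZ n (a : F) P :
  iter n (@dmul F) (a%:P%:F *: P) = a%:P%:F *: iter n (@dmul F) P.
Proof.
elim: n => //= n ->; rewrite dmulZ rderiv_poly derivC tofrac0.
by rewrite scale0r add0r.
Qed.

Fact dscaleAr (a : F) (P Q : dop) : a *: (P * Q) = P * (a *: Q).
Proof.
rewrite !dscaleE [LHS]scaler_sumr; apply: eq_bigr => i _.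
by rewrite iter_dmulZ !scalerA mulrC.
Qed.
HB.instance Definition _ := GRing.Lalgebra_isAlgebra.Build F dop dscaleAr.

End DopRing.

(** * Contiguity *)

Section Contiguity.
Variables (F : fieldType) (A : algType F).
Implicit Types (E P Q u v : A) (c : F).

(** Membership in the left ideal generated by [E]: such a [P] annihilates the solutions of [E]. *)
Definition right_dvd E P := exists Q, P = Q * E.

(** [P] and [P'] carry solutions of [E] to solutions of [E'] and back, and both round trips are
    multiplication by the same nonzero constant. This makes the relation symmetric and transitive,
    and later keeps [P] nonzero modulo [E]. *)
Definition contig E E' := exists P P' c,
  [/\ c != 0, right_dvd E (E' * P), right_dvd E' (E * P'),
      right_dvd E (P' * P - c%:A) & right_dvd E' (P * P' - c%:A)].

Lemma contig_sym E E' : contig E E' -> contig E' E.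
Proof. by move=> [P [P' [c [c0 h1 h2 h3 h4]]]]; exists P', P, c. Qed.

(** The inner round trip [Q' * Q] is [d] modulo [E']. Its error, a left multiple of [E'], becomes a
    left multiple of [E] once [P] stands on its right; the outer round trip then contributes [c]. *)
Lemma right_dvd_back_and_forth E E' P P' Q Q' c d :
    right_dvd E (E' * P) -> right_dvd E (P' * P - c%:A) ->
    right_dvd E' (Q' * Q - d%:A) ->
  right_dvd E ((P' * Q') * (Q * P) - (c * d)%:A).
Proof.
move=> [S hS] [T hT] [U hU].
exists (P' * U * S + d *: T).
have -> : (P' * Q') * (Q * P) = P' * (Q' * Q - d%:A) * P + d *: (P' * P).
  by rewrite mulrBr mulrBl !mulrA -scalerAr mulr1 -scalerAl subrK.
rewrite hU mulrDl -!mulrA hS -scalerAl -hT scalerBr scalerA mulrC.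
by rewrite addrA.
Qed.

Lemma contig_trans E2 E1 E3 : contig E1 E2 -> contig E2 E3 -> contig E1 E3.
Proof.
move=> [P [P' [c [c0 [S hS] [S' hS'] h3 h4]]]] [Q [Q' [d [d0 [T hT] [T' hT'] k3 k4]]]].
exists (Q * P), (P' * Q'), (c * d); split; first by rewrite mulf_neq0.
- by exists (T * S); rewrite mulrA hT -!mulrA hS.
- by exists (S' * T'); rewrite mulrA hS' -!mulrA hT'.
- by apply: (right_dvd_back_and_forth (E' := E2)) => //; exists S.
- by rewrite mulrC; apply: (right_dvd_back_and_forth (E' := E2)) => //; exists T'.
Qed.

(** From the factorisations, [E' * P = P * E] and [E * Q = Q * E'], and both round trips equal [- c]
    modulo the operators. *)
Lemma contig_factor E E' P Q c : c != 0 ->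
  E = Q * P + c%:A -> E' = P * Q + c%:A -> contig E E'.
Proof.
move=> c0 -> ->; exists P, Q, (- c); split; first by rewrite oppr_eq0.
- by exists P; rewrite mulrDl mulrDr -scalerAl -scalerAr mul1r mulr1 mulrA.
- by exists Q; rewrite mulrDl mulrDr -scalerAl -scalerAr mul1r mulr1 mulrA.
- by exists 1; rewrite scaleNr opprK mul1r.
- by exists 1; rewrite scaleNr opprK mul1r.
Qed.

(** Both operators generate the same left ideal, so the identity serves in both directions. *)
Lemma contig_mull u v E : v * u = 1 -> contig (u * E) E.
Proof.
move=> vu; exists 1, 1, 1; split; rewrite ?oner_neq0 ?mulr1 //.
- by exists v; rewrite mulrA vu mul1r.
- by exists u.
- by exists 0; rewrite scale1r subrr mul0r.
- by exists 0; rewrite scale1r subrr mul0r.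
Qed.

Lemma contig_conj u v E : u * v = 1 -> v * u = 1 -> contig E (u * E * v).
Proof.
move=> uv vu; exists u, v, 1; split; rewrite ?oner_neq0 //.
- by exists u; rewrite -mulrA vu mulr1.
- by exists v; rewrite !mulrA vu mul1r.
- by exists 0; rewrite vu scale1r subrr mul0r.
- by exists 0; rewrite uv scale1r subrr mul0r.
Qed.

End Contiguity.

(** * Abstract hypergeometric operators and their unit shifts *)

Section Hypergeometric.
Variables (F : fieldType) (A : algType F) (D z zi : A).
Hypotheses (zzi : z * zi = 1) (ziz : zi * z = 1) (Dz : D * z = z * (D + 1)).
Implicit Types (p q r : {poly F}) (c x : F).

(** When D is the Euler operator z d/dz, this is the generalized hypergeometric operator q(D) - z
    p(D). Only the relation [Dz] is used, so gauge conjugates and pullbacks of the Euler operator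
    are covered too. *)
Definition hyp p q : A := horner_alg D q - z * horner_alg D p.

Lemma horner_alg_shift p :
  horner_alg D p * z = z * horner_alg D (p \Po ('X + 1)).
Proof.
elim/poly_ind: p => [|p c IH]; first by rewrite comp_poly0 !rmorph0 mul0r mulr0.
rewrite comp_polyD comp_polyM comp_polyX comp_polyC !rmorphD !rmorphM /=.
rewrite !horner_algX !horner_algC rmorphD /= horner_algX rmorph1 mulrDl mulrDr.
by rewrite -mulrA Dz mulrA IH -!mulrA -scalerAl -scalerAr mulr1 mul1r.
Qed.

Lemma dvd_XsubC_rem p x : exists r, p = r * ('X - x%:P) + p.[x]%:P.
Proof.
have /factor_theorem[r hr] : root (p - p.[x]%:P) x.
  by rewrite rootE !hornerE subrr.
by exists r; rewrite -hr subrK.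
Qed.

Lemma comp_XsubC_shift x : ('X - x%:P) \Po ('X + 1) = 'X - (x - 1)%:P.
Proof. by rewrite comp_polyB comp_polyX comp_polyC polyCB opprB addrA. Qed.

(** Writing q = r (X - x) + q(x) gives the operator as (r(D) - z p(D)) (D - x) + q(x). In the
    swapped product, moving D - x past z turns it into D - (x - 1), while the r-term is
    unchanged. *)
Lemma contig_hyp_num p q x : q.[x] != 0 ->
  contig (hyp (('X - x%:P) * p) q) (hyp (('X - (x - 1)%:P) * p) q).
Proof.
move=> qx; have [r hr] := dvd_XsubC_rem q x.
apply: (contig_factor (P := horner_alg D ('X - x%:P))
  (Q := horner_alg D r - z * horner_alg D p) qx); rewrite /hyp {1}hr.
- rewrite [X in _ = X + _]mulrBl -mulrA -!rmorphM [p * _]mulrC rmorphD /= horner_algC.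
  by rewrite addrAC.
- rewrite [X in _ = X + _]mulrBr mulrA horner_alg_shift comp_XsubC_shift -mulrA -!rmorphM.
  by rewrite [_ * r]mulrC rmorphD /= horner_algC addrAC.
Qed.

(** The same argument with the roles of p and q exchanged: after multiplication by the inverse of z,
    p is divided by X - x. Moving D - x past that inverse raises the root instead of lowering it. *)
Lemma contig_hyp_den p q x : p.[x] != 0 ->
  contig (hyp p (('X - x%:P) * q)) (hyp p (('X - (x + 1)%:P) * q)).
Proof.
move=> px; have [r hr] := dvd_XsubC_rem p x.
have comm_zi : horner_alg D ('X - x%:P) * zi = zi * horner_alg D ('X - (x + 1)%:P).
  rewrite -[LHS]mul1r -{1}ziz -!mulrA [z * (_ * _)]mulrA.
  have -> : 'X - x%:P = ('X - (x + 1)%:P) \Po ('X + 1) :> {poly F}.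
    by rewrite comp_XsubC_shift addrK.
  by rewrite -horner_alg_shift -mulrA zzi mulr1.
(* Left multiplication by the unit [zi] frees the p-term of z, so that its remainder becomes the
   constant of the factorisation. *)
apply: (contig_trans (E2 := zi * hyp p (('X - x%:P) * q))).
  by apply: contig_sym; apply: contig_mull zzi.
apply: (contig_trans (E2 := zi * hyp p (('X - (x + 1)%:P) * q))); last first.
  by apply: contig_mull zzi.
apply: (contig_factor (P := horner_alg D ('X - x%:P)) (c := - p.[x])
  (Q := zi * horner_alg D q - horner_alg D r)).
- by rewrite oppr_eq0.
- rewrite /hyp mulrBr mulrA ziz mul1r [X in _ = X + _]mulrBl.
  rewrite -mulrA -!rmorphM [q * _]mulrC {1}hr.
  by rewrite rmorphD /= horner_algC opprD scaleNr addrA.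
- rewrite /hyp mulrBr [zi * (z * _)]mulrA ziz mul1r [X in _ = X + _]mulrBr mulrA comm_zi.
  rewrite -mulrA -!rmorphM {1}hr [_ * r]mulrC.
  by rewrite (rmorphD (horner_alg D) (r * _)) /= horner_algC opprD scaleNr addrA.
Qed.

(* The factors D - b_i are those of 3F2 with lower parameters 1 - b_i. *)
Definition hyp32 (a1 a2 a3 b1 b2 : F) : A :=
  hyp (('X + a1%:P) * ('X + a2%:P) * ('X + a3%:P))
      ('X * ('X - b1%:P) * ('X - b2%:P)).

Lemma hyp32_swap12 a1 a2 a3 b1 b2 : hyp32 a1 a2 a3 b1 b2 = hyp32 a2 a1 a3 b1 b2.
Proof. by rewrite /hyp32 [('X + a1%:P) * _]mulrC. Qed.

Lemma hyp32_swap23 a1 a2 a3 b1 b2 : hyp32 a1 a2 a3 b1 b2 = hyp32 a1 a3 a2 b1 b2.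
Proof. by rewrite /hyp32 mulrAC. Qed.

Lemma hyp32_swapb a1 a2 a3 b1 b2 : hyp32 a1 a2 a3 b1 b2 = hyp32 a1 a2 a3 b2 b1.
Proof. by rewrite /hyp32 [X in hyp _ X]mulrAC. Qed.

(** The root moved is -a1; the hypotheses say that X (X - b1) (X - b2) does not vanish there. *)
Lemma contig_hyp32_num a1 a2 a3 b1 b2 :
    a1 != 0 -> a1 + b1 != 0 -> a1 + b2 != 0 ->
  contig (hyp32 a1 a2 a3 b1 b2) (hyp32 (a1 + 1) a2 a3 b1 b2).
Proof.
move=> n0 n1 n2; rewrite /hyp32 -!mulrA.
rewrite (_ : 'X + a1%:P = 'X - (- a1)%:P); last by rewrite polyCN opprK.
rewrite (_ : 'X + (a1 + 1)%:P = 'X - (- a1 - 1)%:P); last first.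
  by rewrite -opprD polyCN opprK.
apply: contig_hyp_num; rewrite !hornerE -!opprD !mulf_neq0 ?oppr_eq0 //.
Qed.

(** The root moved is b1; the hypotheses say that the product of the X + a_i does not vanish
    there. *)
Lemma contig_hyp32_den a1 a2 a3 b1 b2 :
    a1 + b1 != 0 -> a2 + b1 != 0 -> a3 + b1 != 0 ->
  contig (hyp32 a1 a2 a3 b1 b2) (hyp32 a1 a2 a3 (b1 + 1) b2).
Proof.
move=> n1 n2 n3; rewrite /hyp32 -!['X * _ * _]mulrA !['X * (_ * _)]mulrCA.
apply: contig_hyp_den; rewrite !hornerE !mulf_neq0 // addrC //.
Qed.

End Hypergeometric.

Lemma horner_alg_conj (F : fieldType) (A : algType F) (D u v : A) p :
  v * u = 1 -> u * v = 1 -> horner_alg (u * D * v) p = u * horner_alg D p * v.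
Proof.
move=> vu uv; elim/poly_ind: p => [|p c IH]; first by rewrite !rmorph0 mulr0 mul0r.
rewrite !rmorphD !rmorphM /= !horner_algX !horner_algC IH mulrDr mulrDl.
by rewrite -scalerAr mulr1 -scalerAl uv -!mulrA [v * (u * _)]mulrA vu mul1r.
Qed.

Lemma hyp_conj (F : fieldType) (A : algType F) (D z u v : A) p q :
  v * u = 1 -> u * v = 1 -> u * z = z * u ->
  hyp (u * D * v) z p q = u * hyp D z p q * v.
Proof.
move=> vu uv uz; rewrite /hyp !horner_alg_conj // mulrBr mulrBl.
by rewrite !mulrA uz.
Qed.

(** * Reduction modulo an operator *)

Section RightDivision.
Variable F : fieldType.
Implicit Types P Q E : diffop F.

Lemma size_lead_dmul P : P != 0 ->
  size (dmul P) = (size P).+1 /\ lead_coef (dmul P) = lead_coef P.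
Proof.
move=> P0; rewrite /dmul addrC.
have lt : (size (map_poly (@rderiv F) P) < size (P * 'X)%R)%N.
  by rewrite size_mulX // ltnS size_poly.
by rewrite size_polyDl // lead_coefDl // size_mulX // lead_coefMX.
Qed.

Lemma size_lead_iter_dmul n P : P != 0 ->
  size (iter n (@dmul F) P) = (n + size P)%N /\
  lead_coef (iter n (@dmul F) P) = lead_coef P.
Proof.
move=> P0; elim: n => //= n [IHs IHl].
have n0 : iter n (@dmul F) P != 0.
  by rewrite -size_poly_gt0 IHs addn_gt0 size_poly_gt0 P0 orbT.
by have [-> ->] := size_lead_dmul n0; rewrite IHs IHl.
Qed.

(** Orders add under composition: the top coefficient is the product of the two leading
    coefficients, as differentiation does not affect leading terms. *)
Lemma leq_size_dcomp Q E : Q != 0 -> (size E <= size (dcomp Q E))%N.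
Proof.
move=> Q0; have [->|E0] := eqVneq E 0; first by rewrite size_poly0.
rewrite leqNgt; apply/negP => lt.
have sQ : size Q = (size Q).-1.+1 by rewrite prednK ?size_poly_gt0.
have sE : size E = (size E).-1.+1 by rewrite prednK ?size_poly_gt0.
have : (dcomp Q E)`_((size Q).-1 + (size E).-1) = 0.
  by rewrite nth_default // (leq_trans _ (leq_addl _ _)) // -ltnS -sE.
rewrite (dcomp_widen (n := (size Q).-1.+1)); last by rewrite -sQ.
rewrite big_ord_recr coefD /= coef_sum.
rewrite big1 => [|i _]; last first.
  rewrite coefZ [_`__]nth_default ?mulr0 //.
  have [-> _] := size_lead_iter_dmul i E0.
  by rewrite {1}sE addnS -addSn leq_add2r.
have [s l] := size_lead_iter_dmul (size Q).-1 E0.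
rewrite add0r coefZ.
have -> : ((size Q).-1 + (size E).-1 = (size (iter (size Q).-1 (@dmul F) E)).-1)%N.
  by rewrite s {2}sE addnS.
rewrite -/(lead_coef Q) -/(lead_coef (iter _ _ _)) l => /eqP.
by rewrite mulf_eq0 !lead_coef_eq0 (negPf Q0) (negPf E0).
Qed.

Lemma dcompXn n E : dcomp 'X^n E = iter n (@dmul F) E.
Proof.
elim: n => [|n IH]; first by rewrite expr0 dcomp1l.
by rewrite -dmulXn dcomp_dmul IH.
Qed.

(** Right Euclidean division: subtracting c d^m E with the same leading term lowers the order. *)
Lemma dcomp_divp P E : E != 0 ->
  exists Q S, P = dcomp Q E + S /\ (size S < size E)%N.
Proof.
move=> E0; have [n] := ubnP (size P); elim: n P => // n IH P; rewrite ltnS => le.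
have [lt|ge] := ltnP (size P) (size E).
  by exists 0, P; rewrite dcomp0l add0r.
have P0 : P != 0 by rewrite -size_poly_gt0 (leq_trans _ ge) // size_poly_gt0.
pose m := (size P - size E)%N; pose c := lead_coef P / lead_coef E.
have [s l] := size_lead_iter_dmul m E0.
have sP : size P = (size P).-1.+1 by rewrite prednK ?size_poly_gt0.
have [|Q [S [h hS]]] := IH (P - c *: iter m (@dmul F) E).
  rewrite (leq_trans _ le) // sP ltnS; apply/leq_sizeP => j.
  rewrite leq_eqVlt => /orP[/eqP <-|]; rewrite coefB coefZ; last first.
    by rewrite -sP => lt; rewrite !nth_default ?mulr0 ?subr0 // s subnK.
  rewrite -/(lead_coef P).
  have -> : (size P).-1 = (size (iter m (@dmul F) E)).-1 by rewrite s subnK.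
  by rewrite -/(lead_coef _) l divfK ?subrr // lead_coef_eq0.
exists (c *: 'X^m + Q), S; split => //.
by rewrite dcompDl dcompZl dcompXn -addrA -h addrC subrK.
Qed.

(** The remainder of the forward operator modulo [E] acts identically on solutions of [E], so it
    still intertwines and has order below 3. *)
Lemma contig_shift_operator (E E' : dop F) : size (E : diffop F) = 4 ->
  contig E E' -> exists P, is_shift_operator E E' P.
Proof.
move=> sE [P [P' [c [c0 [S hS] _ [T hT] _]]]].
have E0 : (E : diffop F) != 0 by rewrite -size_poly_gt0 sE.
have [Q [P1 [hP ltP1]]] := dcomp_divp P E0.
have {}hP : P = (Q : dop F) * E + P1 :> dop F by [].
exists P1; split; last 1 first.
- exists (S - E' * Q : dop F); rewrite -![dcomp _ _]/(_ * _ : dop F) mulrBl -hS.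
  by rewrite hP mulrDr mulrA addrC addKr.
(* If the remainder were zero, the round trip would put the nonzero constant [c] in the left ideal
   of [E], whose nonzero elements have order at least 3. *)
- apply: contraTneq c0 => P10; rewrite negbK.
  have {}hT : (c%:P%:F)%:P = dcomp (P' * Q - T) E.
    rewrite -alg_polyC -[RHS]/((P' * Q - T) * E : dop F) mulrBl -hT hP P10 addr0.
    by rewrite mulrA opprB addrC subrK.
  have [Z|nz] := eqVneq (P' * Q - T : diffop F) 0.
    by move/eqP: hT; rewrite Z dcomp0l polyC_eq0 tofrac_eq0 polyC_eq0.
  have := leq_size_dcomp E nz; rewrite -hT sE.
  by move=> /leq_trans/(_ (size_polyC_leq1 _)).
- by move: ltP1; rewrite sE /dorder; case: (size P1).
Qed.

End RightDivision.

(** * E3d as a pullback *)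

Section CubicCoefficients.
Variable K : fieldType.

(* The coefficients of the operator product (w d + v + a)(w d + v + b)(w d + v + c)
   for constants a, b, c, with w1, w2 (resp. v1, v2) the first two derivatives
   of w (resp. v). *)
Definition cubic_coefs (w w1 w2 v v1 v2 a b c : K) : seq K :=
  let p0 := w * v1 + (v + b) * (v + c) in
  let p1 := w * (w1 + (v + c)) + (v + b) * w in
  let p2 := w * w in
  let dp0 := w1 * v1 + w * v2 + v1 * (v + c) + (v + b) * v1 in
  let dp1 := w1 * (w1 + (v + c)) + w * (w2 + v1) + v1 * w + (v + b) * w1 in
  let dp2 := w1 * w + w * w1 in
  [:: w * dp0 + (v + a) * p0; w * (dp1 + p0) + (v + a) * p1;
      w * (dp2 + p1) + (v + a) * p2; w * p2].

(** Here w = z/z' and v = (e6/2) w/x, so w d + v is z d/dz conjugated by x^(e6/2), and u normalises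
    the leading coefficient. Derivatives enter as explicit fractions, which leaves identities for
    [field] away from x = 0, 1, -1. *)
Lemma E3d_coefs (x e1 e3 e4 e6 : K) (i : nat) :
  2 != 0 :> K -> 3 != 0 :> K -> x != 0 -> x + 1 != 0 -> x - 1 != 0 ->
  let e2 := - e3 / 2 - e4 / 2 + 3 / 2 - e1 - 3 * e6 / 2 in
  let e5 := e1 + e6 in
  let e7 := 3 - (e1 + e2 + e3 + e4 + e5 + e6) in
  let w := x * (x - 1) / (x + 1) in
  let w1 := (x ^+ 2 + 2 * x - 1) / (x + 1) ^+ 2 in
  let w2 := 4 / (x + 1) ^+ 3 in
  let v := e6 / 2 * (x - 1) / (x + 1) in
  let v1 := e6 / (x + 1) ^+ 2 in
  let v2 := - 2 * e6 / (x + 1) ^+ 3 in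
  let z := - (x - 1) ^+ 2 / (4 * x) in
  let u := 4 * (x + 1) / (x - 1) in
  [:: a01 e5 e6 e7 * x + A00 e1 e2 e3 e4 e5 e6 e7;
      a12 e5 e6 e7 * x ^+ 2 + a11 e1 e2 e3 e4 e5 e6 e7 * x + a10 e1 e2;
      x * (x - 1) * (a21 e1 e2 e3 e4 * x + a20 e1 e2);
      x ^+ 2 * (x - 1) ^+ 2]`_i =
  u * ((cubic_coefs w w1 w2 v v1 v2 0 (- (e3 / 2)) (- (e4 / 2)))`_i -
       z * (cubic_coefs w w1 w2 v v1 v2 (e6 / 2) (e6 / 2 + e1) (e6 / 2 + e2))`_i).
Proof.
move=> n2 n3 x0 x1 y1 /=.
have n54 : 54 != 0 :> K.
  rewrite (_ : 54 = 2 * (3 * (3 * 3))) ?mulf_neq0 //; by ring.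
have n4 : 4 != 0 :> K by rewrite (_ : 4 = 2 * 2) ?mulf_neq0 //; ring.
case: i => [|[|[|[|i]]]] /=; last by rewrite !nth_nil mulr0 subrr mulr0.
all: rewrite /a01 /A00 /a12 /a11 /a10 /a21 /a20.
all: field.
all: rewrite ?x0 ?x1 ?y1 ?n54 ?n4 ?n2 //.
Qed.
End CubicCoefficients.

(** Here [a] stands for (f/g)' and [b] for g', and f' has been expanded by the product rule applied
    to (f/g) g. *)
Lemma quotient_rule (K : fieldType) (a b f g : K) : g != 0 ->
  a = ((a * g + f / g * b) * g - f * b) / g ^+ 2.
Proof. by move=> g0; field. Qed.

Lemma four_neq0 (K : fieldType) : 2 != 0 :> K -> 4 != 0 :> K.
Proof. by move=> ?; rewrite (_ : 4 = 2 * 2) ?mulf_neq0 // -natrM. Qed.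

(** * First-order operators and products of three of them *)

Section FirstOrder.
Variable F : fieldType.
Implicit Types (f g v w : ratfun F) (P : diffop F).

Definition dfun f : dop F := f%:P.
Definition dlin w v : dop F := w *: 'X + v%:P.

Lemma dfun_mul f (P : dop F) : dfun f * P = f *: (P : diffop F) :> diffop F.
Proof.
by rewrite -[LHS]/(dcomp f%:P P) -alg_polyC dcompZl dcomp1l.
Qed.

Lemma dfunM f g : dfun f * dfun g = dfun (f * g).
Proof. by rewrite [LHS]dfun_mul /dfun polyCM mul_polyC. Qed.

Lemma dfunVr f : f != 0 -> dfun f * dfun f^-1 = 1.
Proof. by move=> f0; rewrite dfunM (mulfV f0). Qed.

Lemma dfunVl f : f != 0 -> dfun f^-1 * dfun f = 1.
Proof. by move=> f0; rewrite dfunM (mulVf f0). Qed.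

Lemma dfunC f g : dfun f * dfun g = dfun g * dfun f.
Proof. by rewrite [LHS]dfunM [RHS]dfunM (mulrC f). Qed.

Lemma dlin_mul w v (P : dop F) :
  dlin w v * P = w *: dmul P + v *: (P : diffop F) :> diffop F.
Proof.
rewrite -[_ * P]/(dcomp (w *: 'X + v%:P) P) dcompDl -alg_polyC !dcompZl dcomp1l.
by rewrite -['X]expr1 dcompXn.
Qed.

Lemma coef_dlin_mul w v (P : dop F) i :
  (dlin w v * P : diffop F)`_i =
  w * (rderiv (P : diffop F)`_i + (if i is j.+1 then (P : diffop F)`_j else 0))
  + v * (P : diffop F)`_i.
Proof. by rewrite dlin_mul /= coefD !coefZ coef_dmul. Qed.

Lemma coef_dlin w v i : (dlin w v : diffop F)`_i = [:: v; w]`_i.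
Proof.
rewrite coefD coefZ coefX coefC.
by case: i => [|[|i]] /=; rewrite ?nth_nil ?mulr0 ?mulr1 ?add0r ?addr0.
Qed.

Lemma dmulC f : dmul f%:P = (rderiv f)%:P + f *: 'X.
Proof.
rewrite /dmul mul_polyC; congr (_ + _); apply/polyP => i.
rewrite coef_map_id0; last exact: rderiv0.
rewrite [RHS]coefC [X in rderiv X]coefC.
by case: (i == 0%N); last exact: rderiv0.
Qed.

Lemma dlin_mul_dfun w v f :
  dlin w v * dfun f = dfun f * dlin w v + dfun (w * rderiv f).
Proof.
rewrite [LHS]dlin_mul [X in _ = X + _]dfun_mul dmulC.
rewrite !scalerDr !scalerA !scale_polyC.
by rewrite [f * w]mulrC [f * v]mulrC -[LHS]addrA; exact: addrC.
Qed.

(** The condition makes f an eigenfunction of w d with eigenvalue 1, as z is for z d/dz. *)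
Lemma dlin_mul_dfun_shift w v f : w * rderiv f = f ->
  dlin w v * dfun f = dfun f * (dlin w v + 1).
Proof. by move=> wf; rewrite dlin_mul_dfun wf [RHS]mulrDr mulr1. Qed.

(** Gauge transformation: conjugation by f adds w times the logarithmic derivative of f. *)
Lemma dlin_conj w v f : f != 0 ->
  dfun f^-1 * dlin w v * dfun f = dlin w (v + f^-1 * (w * rderiv f)).
Proof.
move=> f0; rewrite -[LHS]mulrA dlin_mul_dfun [LHS]mulrDr [X in X + _ = _]mulrA.
rewrite [X in X * _ + _ = _](dfunVl f0) [X in X + _ = _]mul1r.
rewrite [X in _ + X = _]dfunM /dlin /dfun polyCD.
by rewrite -[LHS]/(_ + _ : diffop F) addrA.
Qed.

Lemma alg_dfun (a : F) : a%:A = dfun a%:P%:F.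
Proof. by rewrite dscaleE -[1 in LHS]/(1%:P) -mul_polyC -polyCM mulr1. Qed.

Lemma rderiv_const (a : F) : rderiv a%:P%:F = 0.
Proof. by rewrite rderiv_poly derivC tofrac0. Qed.

Lemma rderivN f : rderiv (- f) = - rderiv f.
Proof. by apply/eqP; rewrite -addr_eq0 -rderivD addNr rderiv0. Qed.

Lemma rderiv_div f g : g != 0 ->
  rderiv (f / g) = (rderiv f * g - f * rderiv g) / g ^+ 2.
Proof.
move=> g0; have: rderiv (f / g * g) = rderiv f by rewrite divfK.
by rewrite rderivM => <-; apply: quotient_rule.
Qed.

Lemma coef_cubic w w1 w2 v v1 v2 (a b c : F) i :
    rderiv w = w1 -> rderiv w1 = w2 -> rderiv v = v1 -> rderiv v1 = v2 ->
  (horner_alg (dlin w v) (('X + a%:P) * ('X + b%:P) * ('X + c%:P)) : diffop F)`_i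
  = (cubic_coefs w w1 w2 v v1 v2 a%:P%:F b%:P%:F c%:P%:F)`_i.
Proof.
move=> hw hw1 hv hv1.
have hl (d : F) : horner_alg (dlin w v) ('X + d%:P) = dlin w (v + d%:P%:F).
  rewrite rmorphD /= horner_algX horner_algC alg_dfun /dlin /dfun polyCD.
  by rewrite -[LHS]/(_ + _ : diffop F) addrA.
rewrite !rmorphM /= !hl -mulrA.
have hvd (d : F) : rderiv (v + d%:P%:F) = v1 by rewrite rderivD rderiv_const addr0.
have h0 j := coef_dlin w (v + c%:P%:F) j.
pose p0 := w * v1 + (v + b%:P%:F) * (v + c%:P%:F).
pose p1 := w * (w1 + (v + c%:P%:F)) + (v + b%:P%:F) * w.
have h1 j : (dlin w (v + b%:P%:F) * dlin w (v + c%:P%:F) : diffop F)`_j =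
   [:: p0; p1; w * w]`_j.
  rewrite coef_dlin_mul; case: j => [|[|[|j]]]; rewrite !h0 /=.
  - by rewrite hvd addr0.
  - by rewrite hw.
  - by rewrite rderiv0 add0r mulr0 addr0.
  - by rewrite !nth_nil rderiv0 addr0 !mulr0 addr0.
have dp0 : rderiv p0 = w1 * v1 + w * v2 + v1 * (v + c%:P%:F) + (v + b%:P%:F) * v1.
  by rewrite /p0 rderivD !rderivM !hvd hv1 hw addrA.
have dp1 : rderiv p1 = w1 * (w1 + (v + c%:P%:F)) + w * (w2 + v1) + v1 * w
                       + (v + b%:P%:F) * w1.
  by rewrite /p1 rderivD !rderivM rderivD !hvd hw hw1 addrA.
rewrite coef_dlin_mul; case: i => [|[|[|[|i]]]]; rewrite !h1 /cubic_coefs /=.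
- by rewrite dp0 addr0.
- by rewrite dp1.
- by rewrite rderivM hw.
- by rewrite rderiv0 add0r mulr0 addr0.
- by rewrite !nth_nil rderiv0 addr0 !mulr0 addr0.
Qed.

End FirstOrder.

Section MorphParams.
Variables (F K : fieldType) (k : {rmorphism F -> K}).

Lemma rmorph_A00 e1 e2 e3 e4 e5 e6 e7 :
  k (A00 e1 e2 e3 e4 e5 e6 e7) =
  A00 (k e1) (k e2) (k e3) (k e4) (k e5) (k e6) (k e7).
Proof. by rewrite /A00 fmorph_div; congr (_ / _); rewrite ?rmorph_nat //; ring. Qed.

Lemma rmorph_a01 e5 e6 e7 : k (a01 e5 e6 e7) = a01 (k e5) (k e6) (k e7).
Proof. by rewrite /a01; ring. Qed.

Lemma rmorph_a12 e5 e6 e7 : k (a12 e5 e6 e7) = a12 (k e5) (k e6) (k e7).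
Proof. by rewrite /a12; ring. Qed.

Lemma rmorph_a11 e1 e2 e3 e4 e5 e6 e7 :
  k (a11 e1 e2 e3 e4 e5 e6 e7) =
  a11 (k e1) (k e2) (k e3) (k e4) (k e5) (k e6) (k e7).
Proof. by rewrite /a11; ring. Qed.

Lemma rmorph_a10 e1 e2 : k (a10 e1 e2) = a10 (k e1) (k e2).
Proof. by rewrite /a10; ring. Qed.

Lemma rmorph_a21 e1 e2 e3 e4 : k (a21 e1 e2 e3 e4) = a21 (k e1) (k e2) (k e3) (k e4).
Proof. by rewrite /a21; ring. Qed.

Lemma rmorph_a20 e1 e2 : k (a20 e1 e2) = a20 (k e1) (k e2).
Proof. by rewrite /a20; ring. Qed.

Definition e2d (L : fieldType) (e1 e3 e4 e6 : L) : L :=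
  - e3 / 2 - e4 / 2 + 3 / 2 - e1 - 3 * e6 / 2.

Lemma rmorph_e2d e1 e3 e4 e6 :
  k (e2d e1 e3 e4 e6) = e2d (k e1) (k e3) (k e4) (k e6).
Proof.
by rewrite /e2d !(rmorph_nat, rmorphD, rmorphN, rmorphM, fmorphV).
Qed.

Lemma rmorph_half e : k (e / 2) = k e / 2.
Proof. by rewrite fmorph_div rmorph_nat. Qed.

Lemma rmorph_e7 e1 e2 e3 e4 e5 e6 :
  k (3 - (e1 + e2 + e3 + e4 + e5 + e6)) =
  3 - (k e1 + k e2 + k e3 + k e4 + k e5 + k e6).
Proof. by ring. Qed.

End MorphParams.

Section Pullback.
Variable F : fieldType.
Hypotheses (F2 : 2 != 0 :> F) (F3 : 3 != 0 :> F).
Let x : ratfun F := 'X%:F.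
Let k : {rmorphism F -> ratfun F} :=
  GRing.RMorphism.clone _ _ (@FracField.tofrac _ \o polyC) _.

Definition zpull : dop F := dfun (- (x - 1) ^+ 2 / (4 * x)).
Definition zpull_inv : dop F := dfun (- (4 * x) / (x - 1) ^+ 2).
Definition Dpull (e6 : F) : dop F :=
  dlin (x * (x - 1) / (x + 1)) (k e6 / 2 * (x - 1) / (x + 1)).

Let x_neq0 : x != 0. Proof. by rewrite tofrac_eq0 polyX_eq0. Qed.
Let xB1_neq0 : x - 1 != 0.
Proof. by rewrite -tofrac1 -tofracB tofrac_eq0 polyXsubC_eq0. Qed.
Let xD1_neq0 : x + 1 != 0.
Proof. by rewrite -tofrac1 -tofracD tofrac_eq0 -[1]opprK -polyCN polyXsubC_eq0. Qed.
Let K2 : 2 != 0 :> ratfun F.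
Proof. by rewrite -(rmorph_nat k) tofrac_eq0 polyC_eq0. Qed.
Let K3 : 3 != 0 :> ratfun F.
Proof. by rewrite -(rmorph_nat k) tofrac_eq0 polyC_eq0. Qed.
Let K4 : 4 != 0 :> ratfun F.
Proof. exact: four_neq0 K2. Qed.

Let dx : rderiv x = 1. Proof. by rewrite rderiv_poly derivX tofrac1. Qed.
Let d1 : rderiv (1 : ratfun F) = 0. Proof. by rewrite -tofrac1 rderiv_const. Qed.
Let dD1 : rderiv (x + 1) = 1. Proof. by rewrite rderivD dx d1 addr0. Qed.
Let dB1 : rderiv (x - 1) = 1. Proof. by rewrite rderivD rderivN dx d1 subr0. Qed.

Let dnat n : rderiv (n%:R : ratfun F) = 0.
Proof. by rewrite -(rmorph_nat k) rderiv_const. Qed.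

Let w := x * (x - 1) / (x + 1).
Let w1 := (x ^+ 2 + 2 * x - 1) / (x + 1) ^+ 2.
Let w2 := 4 / (x + 1) ^+ 3.

(* [field] and [done] may try to reduce fractions when run in [ratfun F], so each
   identity is proved over an abstract field and then instantiated. *)
Let dw : rderiv w = w1.
Proof.
rewrite /w (rderiv_div _ xD1_neq0) rderivM dx dB1 dD1.
have id (K : fieldType) (y : K) : y + 1 != 0 ->
  ((1 * (y - 1) + y * 1) * (y + 1) - y * (y - 1) * 1) / (y + 1) ^+ 2 =
  (y ^+ 2 + 2 * y - 1) / (y + 1) ^+ 2 by move=> ?; field.
exact (id (ratfun F) x xD1_neq0).
Qed.

Let dw1 : rderiv w1 = w2.
Proof.
rewrite (rderiv_div _ (expf_neq0 2 xD1_neq0)) !expr2 !(rderivD, rderivN, rderivM) dx d1.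
have id (K : fieldType) (y : K) : y + 1 != 0 ->
  ((1 * y + y * 1 + ((0 + 0) * y + 2 * 1) - 0) * ((y + 1) * (y + 1)) -
   (y * y + 2 * y - 1) * ((1 + 0) * (y + 1) + (y + 1) * (1 + 0))) /
   ((y + 1) * (y + 1) * ((y + 1) * (y + 1))) = 4 / (y + 1) ^+ 3 by move=> ?; field.
exact (id (ratfun F) x xD1_neq0).
Qed.

Section Gauge.
Variable e : F.
Let v := k e / 2 * (x - 1) / (x + 1).
Let v1 := k e / (x + 1) ^+ 2.
Let v2 := - 2 * k e / (x + 1) ^+ 3.

Let dv : rderiv v = v1.
Proof.
rewrite /v (rderiv_div _ xD1_neq0) rderivM (rderiv_div _ K2) dB1 dD1.
rewrite [rderiv (k e)]rderiv_const (dnat 2).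
have id (K : fieldType) (y a : K) : 2 != 0 :> K -> y + 1 != 0 ->
  (((0 * 2 - a * 0) / 2 ^+ 2 * (y - 1) + a / 2 * 1) * (y + 1) - a / 2 * (y - 1) * 1)
   / (y + 1) ^+ 2 = a / (y + 1) ^+ 2 by move=> h2 h; field; rewrite h h2 four_neq0.
exact (id (ratfun F) x (k e) K2 xD1_neq0).
Qed.

Let dv1 : rderiv v1 = v2.
Proof.
rewrite (rderiv_div _ (expf_neq0 2 xD1_neq0)) !expr2 rderivM dD1.
rewrite [rderiv (k e)]rderiv_const.
have id (K : fieldType) (y a : K) : y + 1 != 0 ->
  (0 * ((y + 1) * (y + 1)) - a * (1 * (y + 1) + (y + 1) * 1)) /
   ((y + 1) * (y + 1) * ((y + 1) * (y + 1))) = - 2 * a / (y + 1) ^+ 3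
  by move=> ?; field.
exact (id (ratfun F) x (k e) xD1_neq0).
Qed.

Lemma coef_Dpull_cubic a b c i :
  (horner_alg (Dpull e) (('X + a%:P) * ('X + b%:P) * ('X + c%:P)) : diffop F)`_i
  = (cubic_coefs w w1 w2 v v1 v2 (k a) (k b) (k c))`_i.
Proof. exact: coef_cubic. Qed.

End Gauge.

Lemma coef_E3 e1 e2 e3 e4 e5 e6 e7 i :
  (E3 e1 e2 e3 e4 e5 e6 e7)`_i =
  [:: k (a01 e5 e6 e7) * x + k (A00 e1 e2 e3 e4 e5 e6 e7);
      k (a12 e5 e6 e7) * x ^+ 2 + k (a11 e1 e2 e3 e4 e5 e6 e7) * x + k (a10 e1 e2);
      x * (x - 1) * (k (a21 e1 e2 e3 e4) * x + k (a20 e1 e2));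
      x ^+ 2 * (x - 1) ^+ 2]`_i.
Proof.
rewrite /E3 !coefD !coefZ !coefXn coefX coefC -!mul_polyC.
rewrite !(tofracD, tofracM, tofracN, tofrac1).
rewrite /x !expr2.
by case: i => [|[|[|[|i]]]]; rewrite /= ?nth_nil !(mulr0, mulr1, add0r, addr0).
Qed.

Lemma coef_hyp32_Dpull e a1 a2 a3 b1 b2 i :
  (hyp32 (Dpull e) zpull a1 a2 a3 b1 b2 : diffop F)`_i =
  let C := cubic_coefs w w1 w2 (k e / 2 * (x - 1) / (x + 1)) (k e / (x + 1) ^+ 2)
               (- 2 * k e / (x + 1) ^+ 3) in
  (C 0 (- k b1) (- k b2))`_i
  - (- (x - 1) ^+ 2 / (4 * x)) * (C (k a1) (k a2) (k a3))`_i.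
Proof.
rewrite /hyp32 (_ : 'X * ('X - b1%:P) * ('X - b2%:P) =
  ('X + 0%:P) * ('X + (- b1)%:P) * ('X + (- b2)%:P)); last first.
  by rewrite addr0 !polyCN.
rewrite -[LHS]/((horner_alg (Dpull e) _ - _ : diffop F)`_i) coefB dfun_mul coefZ.
by rewrite !coef_Dpull_cubic !rmorphN rmorph0.
Qed.

Lemma E3d_pullback e1 e3 e4 e6 :
  E3d e1 e3 e4 e6 = dfun (4 * (x + 1) / (x - 1)) *
   hyp32 (Dpull e6) zpull (e6 / 2) (e6 / 2 + e1) (e6 / 2 + e2d e1 e3 e4 e6)
     (e3 / 2) (e4 / 2)
   :> dop F.
Proof.
apply/polyP => i; rewrite dfun_mul coefZ coef_hyp32_Dpull /E3d -/(e2d e1 e3 e4 e6).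
rewrite coef_E3 rmorph_A00 rmorph_a01 rmorph_a12 rmorph_a11 rmorph_a10.
rewrite rmorph_a21 rmorph_a20 rmorph_e7 (rmorphD k e1 e6).
rewrite (rmorphD k _ e1) (rmorphD k _ (e2d _ _ _ _)) rmorph_e2d !rmorph_half.
exact: (E3d_coefs (k e1) (k e3) (k e4) (k e6) i K2 K3 x_neq0 xD1_neq0 xB1_neq0).
Qed.

Lemma zpull_mulV : zpull * zpull_inv = 1.
Proof.
rewrite dfunM; have id (K : fieldType) (y : K) : 4 != 0 :> K -> y != 0 -> y - 1 != 0 ->
  - (y - 1) ^+ 2 / (4 * y) * (- (4 * y) / (y - 1) ^+ 2) = 1.
  by move=> h4 h0 h1; field; rewrite h0 h1 h4.
by rewrite (id _ x K4 x_neq0 xB1_neq0).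
Qed.

Lemma zpull_mulVl : zpull_inv * zpull = 1.
Proof. by rewrite dfunM mulrC -dfunM zpull_mulV. Qed.

Lemma Dpull_zpull e : Dpull e * zpull = zpull * (Dpull e + 1).
Proof.
apply: dlin_mul_dfun_shift.
rewrite (rderiv_div _ (mulf_neq0 K4 x_neq0)) !expr2.
rewrite rderivN !rderivM dB1 dx (dnat 4).
have id (K : fieldType) (y : K) : 4 != 0 :> K -> y != 0 -> y - 1 != 0 -> y + 1 != 0 ->
  y * (y - 1) / (y + 1) * ((- (1 * (y - 1) + (y - 1) * 1) * (4 * y) -
    - ((y - 1) * (y - 1)) * (0 * y + 4 * 1)) / (4 * y * (4 * y))) =
  - ((y - 1) * (y - 1)) / (4 * y).
  by move=> h4 h0 h1 h2; field; rewrite h0 h2 h4.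
exact: (id _ x K4 x_neq0 xB1_neq0 xD1_neq0).
Qed.

(** Raising [e] by 2 raises the gauge exponent e/2 by 1, so the two operators differ by conjugation
    with the rational function x. *)
Lemma Dpull_shift e : Dpull (e + 2) = dfun x^-1 * Dpull e * dfun x.
Proof.
rewrite /Dpull (dlin_conj _ _ x_neq0) dx (rmorphD k) rmorph_nat mulr1; congr (dlin _ _).
have id (K : fieldType) (y a : K) : 2 != 0 :> K -> y != 0 -> y + 1 != 0 ->
  (a + 2) / 2 * (y - 1) / (y + 1) =
  a / 2 * (y - 1) / (y + 1) + y^-1 * (y * (y - 1) / (y + 1)).
  by move=> h2 h0 h1; field; rewrite h0 h1 h2.
exact: (id _ x (k e) K2 x_neq0 xD1_neq0).
Qed.

Lemma contig_E3d_hyp32 e1 e3 e4 e6 :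
  contig (E3d e1 e3 e4 e6 : dop F)
    (hyp32 (Dpull e6) zpull (e6 / 2) (e6 / 2 + e1) (e6 / 2 + e2d e1 e3 e4 e6)
      (e3 / 2) (e4 / 2)).
Proof.
rewrite E3d_pullback; apply: contig_mull; apply: dfunVl.
exact: (mulf_neq0 (mulf_neq0 K4 xD1_neq0) (invr_neq0 xB1_neq0)).
Qed.

Lemma contig_Dpull_shift e p q :
  contig (hyp (Dpull e) zpull p q) (hyp (Dpull (e + 2)) zpull p q).
Proof.
have xV := dfunVl x_neq0; have Vx := dfunVr x_neq0.
rewrite (Dpull_shift e).
rewrite (hyp_conj (Dpull e) p q Vx xV (dfunC _ _)).
exact: (contig_conj _ xV Vx).
Qed.

Lemma size_E3d (e1 e3 e4 e6 : F) : size (E3d e1 e3 e4 e6) = 4.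
Proof.
apply/eqP; rewrite eqn_leq; apply/andP; split.
  by apply/leq_sizeP => -[|[|[|[|j]]]] // _; rewrite coef_E3 /= nth_nil.
rewrite ltnNge; apply/negP => /leq_sizeP/(_ 3%N (leqnn _)) /eqP.
rewrite coef_E3; apply/negP.
exact: (mulf_neq0 (expf_neq0 2 x_neq0) (expf_neq0 2 xB1_neq0)).
Qed.

End Pullback.

(** * The shifts *)

(** Each quantity that must be nonzero is, after doubling, an integral affine form containing [e6].
    The condition survives integer shifts and also forces characteristic zero. *)
Definition free_params (F : fieldType) (e1 e3 e4 e6 : F) :=
  forall k0 k1 k3 k4 k6 : int, k6 != 0 ->
  k0%:~R + k1%:~R * e1 + k3%:~R * e3 + k4%:~R * e4 + k6%:~R * e6 != 0.

Section Shifts.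
Variables (F : fieldType) (e1 e3 e4 e6 : F).
Hypothesis free : free_params e1 e3 e4 e6.

Lemma free_nat_neq0 n : n.+1%:R != 0 :> F.
Proof.
apply: contraTneq (free 0 0 0 0 (k6 := Posz n.+1) isT) => n0.
by rewrite (_ : (Posz n.+1)%:~R = n.+1%:R :> F) // n0 !mul0r !addr0 eqxx.
Qed.

Let F2 : 2 != 0 :> F := free_nat_neq0 1.
Let F3 : 3 != 0 :> F := free_nat_neq0 2.

Lemma free_form_neq0 (f : F) (k0 k1 k3 k4 k6 : int) : k6 != 0 ->
  2 * f = k0%:~R + k1%:~R * e1 + k3%:~R * e3 + k4%:~R * e4 + k6%:~R * e6 -> f != 0.
Proof.
move=> k60 E; apply: contraTneq (free k0 k1 k3 k4 k60) => f0.
by rewrite -E f0 mulr0 eqxx.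
Qed.

(* The exponents at z = 0, i.e., half of those at x = 1. *)
Definition exponent_at1 (q : F) := [\/ q = 0, q = e3 / 2 | q = e4 / 2].

Lemma num0_neq0 q : exponent_at1 q -> e6 / 2 + q != 0.
Proof.
case=> ->.
- by apply: (@free_form_neq0 _ 0 0 0 0 1) => //; field.
- by apply: (@free_form_neq0 _ 0 0 1 0 1) => //; field.
- by apply: (@free_form_neq0 _ 0 0 0 1 1) => //; field.
Qed.

Lemma num1_neq0 q : exponent_at1 q -> e6 / 2 + e1 + q != 0.
Proof.
case=> ->.
- by apply: (@free_form_neq0 _ 0 2 0 0 1) => //; field.
- by apply: (@free_form_neq0 _ 0 2 1 0 1) => //; field.
- by apply: (@free_form_neq0 _ 0 2 0 1 1) => //; field.
Qed.

(** Here [n] counts unit lowerings of the third numerator parameter. After doubling, the coefficient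
    of [e6] is 1 - 3 = -2. *)
Lemma num2_neq0 n q : exponent_at1 q -> e6 / 2 + e2d e1 e3 e4 e6 - n%:R + q != 0.
Proof.
rewrite /e2d; case=> ->.
- by apply: (@free_form_neq0 _ (3 - 2 * n%:Z) (-2) (-1) (-1) (-2)) => //; field.
- by apply: (@free_form_neq0 _ (3 - 2 * n%:Z) (-2) 0 (-1) (-2)) => //; field.
- by apply: (@free_form_neq0 _ (3 - 2 * n%:Z) (-2) (-1) 0 (-2)) => //; field.
Qed.

Notation H e a0 a1 a2 := (hyp32 (Dpull e) (zpull F) a0 a1 a2).

Lemma contig_num_up e a0 a1 a2 :
  (forall q, exponent_at1 q -> a0 + q != 0) ->
  contig (H e a0 a1 a2 (e3 / 2) (e4 / 2)) (H e (a0 + 1) a1 a2 (e3 / 2) (e4 / 2)).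
Proof.
move=> h; apply: (contig_hyp32_num (Dpull_zpull F2 e)).
- by rewrite -[a0]addr0; apply: h; apply: Or31.
- by apply: h; apply: Or32.
- by apply: h; apply: Or33.
Qed.

(** Lowering is raising from [a2 - 1] read backwards, with the third parameter brought to the
    front. *)
Lemma contig_num_down e a0 a1 a2 :
  (forall q, exponent_at1 q -> a2 - 1 + q != 0) ->
  contig (H e a0 a1 a2 (e3 / 2) (e4 / 2)) (H e a0 a1 (a2 - 1) (e3 / 2) (e4 / 2)).
Proof.
move=> h; apply: contig_sym.
rewrite ![H e a0 a1 _ _ _]hyp32_swap23 ![H e a0 _ a1 _ _]hyp32_swap12.
by rewrite -{2}(subrK 1 a2); apply: contig_num_up.
Qed.

Let a0 := e6 / 2.
Let a1 := e6 / 2 + e1.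
Let a2 := e6 / 2 + e2d e1 e3 e4 e6.

Let a2B1 q : exponent_at1 q -> a2 - 1 + q != 0.
Proof. exact: (num2_neq0 1). Qed.

Let a2B2 q : exponent_at1 q -> a2 - 1 - 1 + q != 0.
Proof.
by rewrite (_ : a2 - 1 - 1 = a2 - 2%:R); [apply: num2_neq0|rewrite -addrA -opprD].
Qed.

(** The sum e1 + e2 is fixed, so [a1] rises by 1, [a2] falls by 1 and [a0] stays. *)
Lemma contig_E3d_e1 : contig (E3d e1 e3 e4 e6 : dop F) (E3d (e1 + 1) e3 e4 e6).
Proof.
apply: contig_trans (contig_E3d_hyp32 F2 F3 _ _ _ _) _.
apply: contig_trans (contig_sym (contig_E3d_hyp32 F2 F3 _ _ _ _)).
rewrite (_ : e6 / 2 + (e1 + 1) = a1 + 1); last by rewrite addrA.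
rewrite (_ : e6 / 2 + e2d (e1 + 1) e3 e4 e6 = a2 - 1); last by rewrite /a2 /e2d; ring.
apply: (contig_trans (E2 := H e6 a0 a1 (a2 - 1) (e3 / 2) (e4 / 2))).
  exact: contig_num_down.
rewrite ![H e6 a0 _ _ _ _]hyp32_swap12.
exact: (contig_num_up _ _ _ num1_neq0).
Qed.

Lemma contig_hyp32_e3 : contig (H e6 a0 a1 a2 (e3 / 2) (e4 / 2))
  (H e6 a0 a1 (a2 - 1) (e3 / 2 + 1) (e4 / 2)).
Proof.
apply: (contig_trans (E2 := H e6 a0 a1 (a2 - 1) (e3 / 2) (e4 / 2))).
  exact: contig_num_down.
apply: (contig_hyp32_den (zpull_mulV F2) (zpull_mulVl F2) (Dpull_zpull F2 e6)).
- by apply: num0_neq0; apply: Or32.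
- by apply: num1_neq0; apply: Or32.
- by apply: a2B1; apply: Or32.
Qed.

Lemma contig_E3d_e3 : contig (E3d e1 e3 e4 e6 : dop F) (E3d e1 (e3 + 2) e4 e6).
Proof.
apply: contig_trans (contig_E3d_hyp32 F2 F3 _ _ _ _) _.
apply: contig_trans (contig_sym (contig_E3d_hyp32 F2 F3 _ _ _ _)).
rewrite (_ : (e3 + 2) / 2 = e3 / 2 + 1); last by field.
rewrite (_ : e6 / 2 + e2d e1 (e3 + 2) e4 e6 = a2 - 1); last by rewrite /a2 /e2d; field.
exact: contig_hyp32_e3.
Qed.

(** Here e2 falls by 3, so [a2] falls by 2 while [a0] and [a1] rise by 1; the gauge exponent also
    rises by 1. *)
Lemma contig_E3d_e6 : contig (E3d e1 e3 e4 e6 : dop F) (E3d e1 e3 e4 (e6 + 2)).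
Proof.
apply: contig_trans (contig_E3d_hyp32 F2 F3 _ _ _ _) _.
apply: contig_trans (contig_sym (contig_E3d_hyp32 F2 F3 _ _ _ _)).
rewrite (_ : (e6 + 2) / 2 + e1 = a1 + 1); last by rewrite /a1; field.
rewrite (_ : (e6 + 2) / 2 + e2d e1 e3 e4 (e6 + 2) = a2 - 1 - 1); last first.
  by rewrite /a2 /e2d; field.
rewrite (_ : (e6 + 2) / 2 = a0 + 1); last by rewrite /a0; field.
apply: contig_trans (contig_Dpull_shift F2 _ _ _).
apply: (contig_trans (E2 := H e6 (a0 + 1) a1 a2 (e3 / 2) (e4 / 2))).
  exact: (contig_num_up _ _ _ num0_neq0).
apply: (contig_trans (E2 := H e6 (a0 + 1) (a1 + 1) a2 (e3 / 2) (e4 / 2))).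
  rewrite ![H e6 (a0 + 1) _ _ _ _]hyp32_swap12.
  exact: (contig_num_up _ _ _ num1_neq0).
apply: (contig_trans (E2 := H e6 (a0 + 1) (a1 + 1) (a2 - 1) (e3 / 2) (e4 / 2))).
  exact: contig_num_down.
exact: contig_num_down.
Qed.

End Shifts.

(** * The [e4] shift by symmetry, and both signs *)

Section SignedShifts.
Variables (F : fieldType).
Implicit Types e : F.

(** The pullback form is visibly symmetric in the two exponents e3/2 and e4/2. *)
Lemma E3d_swap34 e1 e3 e4 e6 : 2 != 0 :> F -> 3 != 0 :> F ->
  E3d e1 e3 e4 e6 = E3d e1 e4 e3 e6.
Proof.
move=> F2 F3; rewrite (E3d_pullback F2 F3 e1 e3) (E3d_pullback F2 F3 e1 e4).
rewrite [X in _ * X]hyp32_swapb.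
rewrite (_ : e2d e1 e3 e4 e6 = e2d e1 e4 e3 e6) //.
by rewrite /e2d; ring.
Qed.

Lemma free_params_swap34 e1 e3 e4 e6 :
  free_params e1 e3 e4 e6 -> free_params e1 e4 e3 e6.
Proof. by move=> h k0 k1 k3 k4 k6 k60; rewrite [X in X + _]addrAC; apply: h. Qed.

Lemma contig_E3d_e4 e1 e3 e4 e6 : free_params e1 e3 e4 e6 ->
  contig (E3d e1 e3 e4 e6 : dop F) (E3d e1 e3 (e4 + 2) e6).
Proof.
move=> h; have F2 := free_nat_neq0 h 1; have F3 := free_nat_neq0 h 2.
rewrite ![E3d e1 e3 _ _]E3d_swap34 //.
exact: contig_E3d_e3 (free_params_swap34 h).
Qed.

Lemma free_params_shift e1 e3 e4 e6 (n1 n3 n4 n6 : int) :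
  free_params e1 e3 e4 e6 ->
  free_params (e1 + n1%:~R) (e3 + n3%:~R) (e4 + n4%:~R) (e6 + n6%:~R).
Proof.
move=> h k0 k1 k3 k4 k6 k60.
have := h (k0 + k1 * n1 + k3 * n3 + k4 * n4 + k6 * n6) k1 k3 k4 k6 k60.
by congr (_ != 0); ring.
Qed.

(** A negative shift is the positive one started from the lowered parameters, which are still
    generic, read backwards. *)
Lemma contig_E3d_shift e1 e3 e4 e6 (s : int) : s = 1 \/ s = -1 ->
    free_params e1 e3 e4 e6 ->
  [/\ contig (E3d e1 e3 e4 e6 : dop F) (E3d (e1 + s%:~R) e3 e4 e6),
      contig (E3d e1 e3 e4 e6 : dop F) (E3d e1 (e3 + (2 * s)%:~R) e4 e6),
      contig (E3d e1 e3 e4 e6 : dop F) (E3d e1 e3 (e4 + (2 * s)%:~R) e6) &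
      contig (E3d e1 e3 e4 e6 : dop F) (E3d e1 e3 e4 (e6 + (2 * s)%:~R))].
Proof.
case=> -> h.
  split; [exact: contig_E3d_e1 h | exact: contig_E3d_e3 h
         | exact: contig_E3d_e4 h | exact: contig_E3d_e6 h].
have sub2 (e : F) : e + (2 * -1)%:~R + 2 = e by ring.
have sub1 (e : F) : e + (-1)%:~R + 1 = e by ring.
split; apply: contig_sym.
- have := @free_params_shift _ _ _ _ (-1) 0 0 0 h; rewrite !addr0.
  by move=> /contig_E3d_e1; rewrite sub1.
- have := @free_params_shift _ _ _ _ 0 (2 * -1) 0 0 h; rewrite !addr0.
  by move=> /contig_E3d_e3; rewrite sub2.
- have := @free_params_shift _ _ _ _ 0 0 (2 * -1) 0 h; rewrite !addr0.
  by move=> /contig_E3d_e4; rewrite sub2.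
- have := @free_params_shift _ _ _ _ 0 0 0 (2 * -1) h; rewrite !addr0.
  by move=> /contig_E3d_e6; rewrite sub2.
Qed.

End SignedShifts.

(** * Genericity of the indeterminates and the conclusion *)

Lemma free_params_par (R : realType) :
  free_params (par R (inord 0)) (par R (inord 1)) (par R (inord 2)) (par R (inord 3)).
Proof.
move=> k0 k1 k3 k4 k6 k60.
pose p : {mpoly R[i][4]} := k0%:~R + k1%:~R * 'X_(inord 0) + k3%:~R * 'X_(inord 1)
  + k4%:~R * 'X_(inord 2) + k6%:~R * 'X_(inord 3).
rewrite (_ : _ + _ = p%:F); last by rewrite !(rmorphD, rmorphM, rmorph_int).
rewrite tofrac_eq0; apply: contra_neq k60 => p0.
(* Evaluation at e1 = e3 = e4 = 0 and e6 = t leaves k0 + k6 t; its vanishing at t = 0 and t = 1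
   gives k6 = 0. *)
pose v t (j : 'I_4) : R[i] := (j == inord 3)%:R * t.
have pv t : (k0%:~R + k6%:~R * t : R[i]) = 0.
  have : meval (v t) p = 0 by rewrite p0 rmorph0.
  rewrite /p !(rmorphD, rmorphM, rmorph_int) /= !mevalXU /v.
  by rewrite -!val_eqE /= !inordK // !mul0r !mulr0 !addr0 mul1r.
have := pv 1; have := pv 0; rewrite mulr0 addr0 mulr1 => ->.
by rewrite add0r => /eqP; rewrite intr_eq0 => /eqP.
Qed.

Theorem theorem5p11 (R : realType) (s : int) (hs : s = 1 \/ s = -1) :
  [/\ E3d_has_shift_operator R s 0 0 0,
      E3d_has_shift_operator R 0 (2 * s) 0 0,
      E3d_has_shift_operator R 0 0 (2 * s) 0
    & E3d_has_shift_operator R 0 0 0 (2 * s)].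
Proof.
have [c1 c3 c4 c6] := contig_E3d_shift hs (@free_params_par R).
split; rewrite /E3d_has_shift_operator !addr0;
  by apply: contig_shift_operator => //; apply: size_E3d.
Qed.
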